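(* Let $n,K\ge 1$ be integers, let $\pi_1,\dots,\pi_K>0$ with $\sum_{c=1}^K\pi_c=1$, and let $f_1,\dots,f_K$ be probability densities on $\mathbb{R}^n$ (with respect to Lebesgue measure). Let $X$ have the mixture density $p_X(x)=\sum_{c=1}^K\pi_c f_c(x)$, and assume that its differential entropy $h(X)$ exists and is finite. Put $z_{c,d}=\int_{\mathbb{R}^n}f_c(x)f_d(x)\,dx$ for $1\le c,d\le K$. Then $$h(X)\ \ge\ h_{\mathsf L}(X):=-\sum_{c=1}^K\pi_c\,\log_2\!\Big(\sum_{d=1}^K\pi_d\,z_{c,d}\Big).$$
   Context: The differential entropy (in bits) is $h(X)=-\int_{\mathbb{R}^n}p_X(x)\log_2 p_X(x)\,dx$, with $0\log_2 0=0$. The overlaps $z_{c,d}$ take values in $[0,+\infty]$; if some sum $\sum_d\pi_d z_{c,d}$ equals $+\infty$, then $-\log_2(+\infty)=-\infty$ and $h_{\mathsf L}(X)=-\infty$. (Each such sum is strictly positive because $z_{c,c}>0$.) *)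

(* Defs.v *)
From HB Require Import structures.
From mathcomp Require Import all_boot all_order all_algebra.
From mathcomp Require Import all_classical all_reals all_analysis.
From mathcomp Require Import measurable_realfun.

Set Implicit Arguments.
Unset Strict Implicit.
Unset Printing Implicit Defensive.

Import Order.TTheory GRing.Theory Num.Theory numFieldNormedType.Exports.

Local Open Scope classical_set_scope.
Local Open Scope ring_scope.
Local Open Scope charge_scope.
Local Open Scope ereal_scope.

(* R^n with its Borel sigma-algebra, generated by the coordinates. *)
Notation Rn R n := (n.-tuple (measurableTypeR R)).

Definition rn_cons {R : realType} {n : nat} (x : measurableTypeR R * Rn R n) :
  Rn R n.+1 := [tuple of x.1 :: x.2].

(* The n-fold product of the one-dimensional Lebesgue measure; its value on
   boxes is computed in lebesgue_box. *)
Fixpoint lebesgue {R : realType} (n : nat) : set (Rn R n) -> \bar R :=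
  match n with
  | 0 => \d_ ([tuple] : Rn R 0)
  | m.+1 => pushforward (@lebesgue_measure R \x @lebesgue R m) rn_cons
  end.

Section lebesgue_is_measure.
Context {R : realType}.

Lemma measurable_rn_cons n : measurable_fun setT (@rn_cons R n).
Proof. exact: measurable_cons. Qed.

Let rn_uncons n (t : Rn R n.+1) : measurableTypeR R * Rn R n :=
  (thead t, [tuple of behead t]).

Let rn_consK n : cancel (@rn_cons R n) (@rn_uncons n).
Proof.
by move=> [x t]; rewrite /rn_uncons /rn_cons theadE; congr pair; exact/val_inj.
Qed.

Let measurable_rn_uncons n : measurable_fun setT (@rn_uncons n).
Proof.
apply/measurable_fun_pairP; split; first exact: measurable_tnth.
exact: measurable_behead.
Qed.

Let sigma_finite_pushforward d1 d2 (T1 : measurableType d1)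
    (T2 : measurableType d2) (mu : {measure set T1 -> \bar R})
    (f : T1 -> T2) (g : T2 -> T1) :
  sigma_finite setT mu ->
  measurable_fun setT f -> measurable_fun setT g -> cancel f g ->
  exists nu : {sigma_finite_measure set T2 -> \bar R}, pushforward mu f = nu.
Proof.
move=> [F FT Foo] mf mg fK.
pose m : {measure set T2 -> \bar R} :=
  measure_function_pushforward__canonical__measure_function_Measure mu mf.
have sf : sigma_finite setT m.
  exists (fun k => g @^-1` F k).
    by rewrite -preimage_bigcup -FT preimage_setT.
  move=> k; have [mF Fk] := Foo k; split.
    by rewrite -[X in measurable X]setTI; exact: mg.
  rewrite /= /pushforward -comp_preimage.
  by rewrite (_ : g \o f = id) ?preimage_id //; apply/funext.
pose nuM := Measure_isSigmaFinite.Build _ _ _ (m : set T2 -> \bar R) sf.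
pose nu : {sigma_finite_measure set T2 -> \bar R} :=
  HB.pack (m : set T2 -> \bar R) m nuM.
by exists nu.
Qed.

Let sigma_finite_prod d1 d2 (T1 : measurableType d1) (T2 : measurableType d2)
    (m1 : {sigma_finite_measure set T1 -> \bar R})
    (m2 : {sigma_finite_measure set T2 -> \bar R}) :
  sigma_finite setT (m1 \x m2).
Proof.
have /sigma_finiteP[F [TF ndF Foo]] := sigma_finiteT m1.
have /sigma_finiteP[G [TG ndG Goo]] := sigma_finiteT m2.
exists (fun k => F k `*` G k).
  rewrite -setXTT TF TG predeqE => -[x y]; split.
    move=> [/= [i _ Fix] [j _ Gjy]]; exists (maxn i j) => //; split.
    - by move: x Fix; exact/subsetPset/ndF/leq_maxl.
    - by move: y Gjy; exact/subsetPset/ndG/leq_maxr.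
  by move=> [i _ []/= ? ?]; split; exists i.
move=> k; have [? ?] := Foo k; have [? ?] := Goo k.
split; first exact: measurableX.
by rewrite product_measure1E// lte_mul_pinfty// ge0_fin_numE.
Qed.

Let lebesgue_structure n :
  exists mu : {sigma_finite_measure set (Rn R n) -> \bar R},
    @lebesgue R n = mu.
Proof.
elim: n => [|n [mu muE]]; first by exists \d_ ([tuple] : Rn R 0).
rewrite /= muE.
exact: (sigma_finite_pushforward (sigma_finite_prod (@lebesgue_measure R) mu)
  (@measurable_rn_cons n) (@measurable_rn_uncons n) (@rn_consK n)).
Qed.

Let lebesgue0 n : @lebesgue R n set0 = 0.
Proof. by have [mu ->] := lebesgue_structure n; exact: measure0. Qed.

Let lebesgue_ge0 n A : 0 <= @lebesgue R n A.
Proof. by have [mu ->] := lebesgue_structure n; exact: measure_ge0. Qed.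

Let lebesgue_sigma_additive n : semi_sigma_additive (@lebesgue R n).
Proof.
have [mu ->] := lebesgue_structure n; exact: measure_semi_sigma_additive.
Qed.

HB.instance Definition _ n := isMeasure.Build _ _ _ (@lebesgue R n)
  (@lebesgue0 n) (@lebesgue_ge0 n) (@lebesgue_sigma_additive n).

Let lebesgue_sigma_finite n : sigma_finite setT (@lebesgue R n).
Proof. by have [mu ->] := lebesgue_structure n; exact: sigma_finiteT. Qed.

HB.instance Definition _ n := Measure_isSigmaFinite.Build _ _ _ (@lebesgue R n)
  (@lebesgue_sigma_finite n).

Lemma lebesgue_box n (A : 'I_n -> set (measurableTypeR R)) :
  (forall i, measurable (A i)) ->
  @lebesgue R n [set x | forall i, A i (tnth x i)] =
  \prod_(i < n) lebesgue_measure (A i).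
Proof.
elim: n A => [|n IHn] A mA.
  by rewrite big_ord0 /= diracE mem_set // => -[].
rewrite big_ord_recl -IHn; last by move=> i; exact: mA.
rewrite -product_measure1E //=; last first.
  rewrite [X in measurable X](_ : _ =
      \bigcap_(i in [set: 'I_n]) ((@tnth n _ ^~ i) @^-1` A (lift ord0 i))).
    apply: fin_bigcap_measurable => // i _.
    by rewrite -[X in measurable X]setTI; exact: measurable_tnth.
  by apply/seteqP; split => [x /= h i _|x h i]; exact: h.
rewrite /pushforward; congr (_ _).
apply/seteqP; split => [[x t] /= h|[x t] /= [h0 h] i].
  split=> [|i]; first exact: (h ord0).
  by have := h (lift ord0 i); rewrite tnthS; congr (A _ (tnth _ _)); exact/val_inj.
case: (unliftP ord0 i) => [j ->|-> //].
by rewrite tnthS; have := h j; congr (A _ (tnth _ _)); exact/val_inj.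
Qed.

End lebesgue_is_measure.

(* Base-2 logarithm on [0, +oo]: log2 0 = -oo and log2 +oo = +oo; as
   0 * -oo = 0 in \bar R, the convention 0 log2 0 = 0 is built in. *)
Definition log2 {R : realType} (x : \bar R) : \bar R := lne x * ((ln 2)^-1)%:E.

Section measurable_log2.
Context {R : realType}.

Let measurable_lne : measurable_fun [set: \bar R] (@lne R).
Proof.
apply: (measurability _ (ErealGenOInfty.measurableE R)) => // _ [_ [r ->] <-].
rewrite setTI (_ : _ @^-1` _ = `](expR r)%:E, +oo[%classic).
  exact: emeasurable_itv.
apply/funext => -[s| |]; apply/propext; rewrite /= !in_itv/= ?andbT.
- case: ifPn => [s0|]; rewrite ?lte_fin.
    by split=> //; rewrite ltNge (le_trans s0) ?expR_ge0.
  by rewrite -ltNge => s0; rewrite -[in X in _ <-> X](lnK s0) ltr_expR.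
- by rewrite !ltry.
- by [].
Qed.

Lemma measurable_log2 : measurable_fun [set: \bar R] (@log2 R).
Proof. exact: emeasurable_funM. Qed.

End measurable_log2.

Section density_entropy.
Context {R : realType} {n : nat}.
Implicit Types p q : Rn R n -> R.

Definition is_pdf p : Prop :=
  [/\ measurable_fun setT p,
      forall x, (0 <= p x)%R &
      \int[@lebesgue R n]_x (p x)%:E = 1].

Context {d} {Omega : measurableType d} (P : probability Omega R).
Implicit Types X : {RV P >-> Rn R n}.

Definition has_density X p : Prop :=
  is_pdf p /\
  forall A : set (Rn R n), measurable A ->
    distribution P X A = \int[@lebesgue R n]_(x in A) (p x)%:E.

(* The density p_X of a random vector X, as the Radon-Nikodym derivative of its
   law; it is only determined almost everywhere, see diff_entropyE. *)
Definition density X : Rn R n -> \bar R :=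
  'd (charge_of_finite_measure (distribution P X)) '/d (@lebesgue R n).

Definition entropy_integrand X (x : Rn R n) : \bar R :=
  density X x * log2 (density X x).

(* h(X), in bits. *)
Definition diff_entropy X : \bar R :=
  - \int[@lebesgue R n]_x entropy_integrand X x.

Definition finite_diff_entropy X : Prop :=
  (@lebesgue R n).-integrable setT (entropy_integrand X).

Lemma distribution_dominates X p : has_density X p ->
  charge_of_finite_measure (distribution P X) `<< @lebesgue R n.
Proof.
move=> [[mp p0 p1] XE]; apply/null_content_dominatesP => A mA A0.
rewrite -[LHS]/(distribution P X A) XE //.
by apply: null_set_integral => //; exact/measurable_funTS/measurable_EFinP.
Qed.

Lemma density_ae X p : has_density X p ->
  ae_eq (@lebesgue R n) setT (density X) (EFin \o p).
Proof.
move=> Xp; have dom := distribution_dominates Xp; have [[mp _ _] XE] := Xp.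
apply: integral_ae_eq => //.
- exact: Radon_Nikodym_integrable.
- exact/measurable_EFinP.
- by move=> A _ mA; rewrite -Radon_Nikodym_integral // -XE.
Qed.

Let plog2p p : Rn R n -> \bar R := fun x => (p x)%:E * log2 (p x)%:E.

Let entropy_integrand_ae X p : has_density X p ->
  [/\ measurable_fun setT (entropy_integrand X),
      measurable_fun setT (plog2p p) &
      ae_eq (@lebesgue R n) setT (entropy_integrand X) (plog2p p)].
Proof.
move=> Xp; have [[mp _ _] _] := Xp; have := density_ae Xp => Xpae.
have mX : measurable_fun setT (density X).
  exact: measurable_int (Radon_Nikodym_integrable (distribution_dominates Xp)).
have mEp : measurable_fun setT (fun x => (p x)%:E) by exact/measurable_EFinP.
split.
- apply: emeasurable_funM => //.
  exact: (measurableT_comp measurable_log2 mX).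
- apply: emeasurable_funM => //.
  exact: (measurableT_comp measurable_log2 mEp).
- by apply: filterS Xpae => x /= /[apply]; rewrite /entropy_integrand => ->.
Qed.

Lemma diff_entropyE X p : has_density X p ->
  diff_entropy X = - \int[@lebesgue R n]_x ((p x)%:E * log2 (p x)%:E).
Proof.
by move=> /entropy_integrand_ae[mX mp Xp]; congr (- _); exact: ae_eq_integral.
Qed.

Lemma finite_diff_entropyE X p : has_density X p ->
  finite_diff_entropy X <->
  (@lebesgue R n).-integrable setT (fun x => (p x)%:E * log2 (p x)%:E).
Proof.
move=> /entropy_integrand_ae[mX mp Xp].
rewrite /finite_diff_entropy; split=> /integrableP[_ foo]; apply/integrableP;
  split=> //; move: foo; congr (_ < _); apply: ae_eq_integral => //;
  [exact: measurableT_comp..| |exact: measurableT_comp|exact: measurableT_comp|].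
- exact: ae_eq_abse.
- exact/ae_eq_abse/ae_eq_sym.
Qed.

End density_entropy.

Section mixture.
Context {R : realType} {n K : nat}.
Variables (pi : 'I_K -> R) (f : 'I_K -> Rn R n -> R).

Definition mixture (x : Rn R n) : R := (\sum_(c < K) pi c * f c x)%R.

Definition overlap (c d : 'I_K) : \bar R :=
  \int[@lebesgue R n]_x (f c x * f d x)%:E.

Definition entropy_lower_bound : \bar R :=
  - \sum_(c < K) (pi c)%:E * log2 (\sum_(d < K) (pi d)%:E * overlap c d).

End mixture.

(* Main.v *)
Require Import Defs.
From HB Require Import structures.
From mathcomp Require Import all_boot all_order all_algebra.
From mathcomp Require Import all_classical all_reals all_analysis.
From mathcomp Require Import measurable_realfun.
From mathcomp Require Import ring lra.

(** Write [s_c] for the integral of [f_c * p], i.e. the sum over [d] of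
    [pi_d * z_(c,d)]. If every [s_c] is finite, the tangent line of [ln] at
    [s_c] gives [ln p <= ln s_c + p / s_c - 1]; averaging this against
    [pi_c * f_c] over [c] bounds [p ln p] pointwise by an integrable function
    whose integral is the sum over [c] of [pi_c * ln s_c]. If some [s_c] is
    infinite, the lower bound is [-oo], because no other [s_d] vanishes. *)

Set Implicit Arguments.
Unset Strict Implicit.
Unset Printing Implicit Defensive.

Import Order.TTheory GRing.Theory Num.Theory numFieldNormedType.Exports.

Local Open Scope classical_set_scope.
Local Open Scope ring_scope.
Local Open Scope ereal_scope.

Section log2.
Context {R : realType}.
Implicit Types u s : R.

Lemma ln2_gt0 : (0 < ln 2 :> R)%R.
Proof. by rewrite ln_gt0 // ltr1n. Qed.

Lemma log2_EFin u : (0 < u)%R -> log2 u%:E = (ln u / ln 2)%:E.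
Proof. by move=> u0; rewrite /log2 lne_EFin. Qed.

Lemma log2_pinfty : log2 (+oo : \bar R) = +oo.
Proof. by rewrite /log2 /= gt0_mulye // lte_fin invr_gt0 ln2_gt0. Qed.

(** At [u = 0] both sides vanish: [0 * -oo = 0] in [\bar R], and on the right the factor [u] kills
    whatever value [ln 0] has. *)
Lemma mule_log2_EFin u : (0 <= u)%R ->
  u%:E * log2 u%:E = (u * (ln u / ln 2))%:E.
Proof.
rewrite le0r => /predU1P[->|u0]; first by rewrite mul0e mul0r.
by rewrite log2_EFin.
Qed.

(** Rescaling by [s] reduces this to the tangent at 1: [ln (1 + t) <= t] with [t = u / s - 1]. *)
Lemma ln_le_tangent u s : (0 < u)%R -> (0 < s)%R ->
  (ln u <= ln s + (u / s - 1))%R.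
Proof.
move=> u0 s0; have us0 : (0 < u / s)%R by rewrite divr_gt0.
have : (ln (1 + (u / s - 1)) <= u / s - 1)%R by apply: le_ln1Dx; lra.
by rewrite addrC subrK ln_div ?posrE //; lra.
Qed.

End log2.

Section mixture.
Context {R : realType} {n K : nat}.
Variables (pi : 'I_K -> R) (f : 'I_K -> Rn R n -> R).
Hypothesis pi_gt0 : forall c, (0 < pi c)%R.
Hypothesis f_pdf : forall c, is_pdf (f c).

Let f_ge0 c x : (0 <= f c x)%R. Proof. by have [] := f_pdf c. Qed.

Let mf c : measurable_fun setT (f c). Proof. by have [] := f_pdf c. Qed.

Lemma mixture_ge0 x : (0 <= mixture pi f x)%R.
Proof. by apply: sumr_ge0 => c _; rewrite mulr_ge0 // ltW. Qed.

Lemma component_le_mixture c x : (pi c * f c x <= mixture pi f x)%R.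
Proof.
rewrite /mixture (bigD1 c) //= lerDl; apply: sumr_ge0 => i _.
by rewrite mulr_ge0 // ltW.
Qed.

Lemma measurable_mixture : measurable_fun setT (mixture pi f).
Proof.
by apply: measurable_sum => c; apply: measurable_funM => //; exact: mf.
Qed.

Let measurable_overlap c :
  measurable_fun setT (fun x => (f c x * mixture pi f x)%:E).
Proof.
by apply/measurable_EFinP/measurable_funM => //; exact: measurable_mixture.
Qed.

Let overlap_integrand_ge0 c x : 0 <= (f c x * mixture pi f x)%:E.
Proof. by rewrite lee_fin mulr_ge0 // mixture_ge0. Qed.

(** Nonnegativity lets the sum and the weights pass through the integral even when some overlap is
    infinite. *)
Lemma sum_overlapE c : \sum_(d < K) (pi d)%:E * overlap f c d =
  \int[@lebesgue R n]_x (f c x * mixture pi f x)%:E.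
Proof.
under eq_integral do rewrite /mixture mulr_sumr -sumEFin.
rewrite ge0_integral_sum //; last 2 first.
- move=> d; apply/measurable_EFinP/measurable_funM => //.
  by apply: measurable_funM => //; exact: mf.
- by move=> d x _; rewrite lee_fin !mulr_ge0 // ltW.
apply: eq_bigr => d _; rewrite -ge0_integralZl_EFin //.
- by apply: eq_integral => x _; rewrite -EFinM mulrCA.
- by move=> x _; rewrite lee_fin mulr_ge0.
- by apply/measurable_EFinP/measurable_funM.
- exact: ltW.
Qed.

(** If the integral of [f c * p] vanished, [f c * p] would be 0 almost everywhere; since
    [pi c * f c <= p], so would [f c], against its total mass 1. *)
Lemma sum_overlap_gt0 c : 0 < \sum_(d < K) (pi d)%:E * overlap f c d.
Proof.
rewrite sum_overlapE lt_neqAle integral_ge0 ?andbT; last by move=> x _.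
apply/eqP => /esym fp0; have [_ _ fc1] := f_pdf c.
have fp_ae : ae_eq (@lebesgue R n) setT
    (fun x => (f c x * mixture pi f x)%:E) (cst 0).
  apply/(ae_eq_integral_abs _ measurableT) => //; rewrite -[RHS]fp0.
  by apply: eq_integral => x _; rewrite gee0_abs.
have fc_ae : ae_eq (@lebesgue R n) setT (EFin \o f c) (cst 0).
  apply: filterS fp_ae => x /= /[apply] -[/eqP].
  rewrite mulf_eq0 => /orP[/eqP -> //|/eqP p0]; congr EFin.
  have := component_le_mixture c x; rewrite p0 pmulr_rle0 // => fc0.
  by apply/eqP; rewrite eq_le fc0 f_ge0.
have := ae_eq_integral _ _ measurableT _ _ fc_ae.
rewrite integral0 fc1 => /(_ _ _)/eqP; rewrite onee_eq0 => h.
by apply: notF; apply: h => //; exact/measurable_EFinP.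
Qed.

Section finite_overlap.
Variable s : 'I_K -> R.
Hypothesis overlap_s : forall c,
  \sum_(d < K) (pi d)%:E * overlap f c d = (s c)%:E.

Let s_gt0 c : (0 < s c)%R.
Proof. by rewrite -lte_fin -overlap_s sum_overlap_gt0. Qed.

(** The averaged tangent bound is expanded into multiples of [f c] and [f c * p], whose integrals
    are 1 and [s c]. *)
Lemma mixture_log2_le x :
  (mixture pi f x)%:E * log2 (mixture pi f x)%:E <=
  \sum_(c < K) ((pi c * (ln (s c) - 1) / ln 2)%:E * (f c x)%:E +
                (pi c / s c / ln 2)%:E * (f c x * mixture pi f x)%:E).
Proof.
rewrite mule_log2_EFin ?mixture_ge0 //.
under eq_bigr do rewrite -!EFinM -EFinD.
rewrite sumEFin lee_fin [X in (X * _)%R]/mixture mulr_suml; apply: ler_sum => c _.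
(* Where [f c x = 0] the mixture may vanish and the tangent bound fail to apply, but both sides are
   0; elsewhere the mixture is positive. *)
have [->|fc_neq0] := eqVneq (f c x) 0%R; first by rewrite !(mulr0,mul0r) addr0.
have pif_gt0 : (0 < pi c * f c x)%R by rewrite mulr_gt0 // lt0r fc_neq0 f_ge0.
have p_gt0 := lt_le_trans pif_gt0 (component_le_mixture c x).
rewrite [leRHS](_ : _ = pi c * f c x *
    ((ln (s c) + (mixture pi f x / s c - 1)) / ln 2))%R; last first.
  by field; rewrite !gt_eqF ?ln2_gt0.
by rewrite ler_pM2l // ler_pM2r ?invr_gt0 ?ln2_gt0 // ln_le_tangent.
Qed.

Lemma integral_mixture_log2_le :
  (@lebesgue R n).-integrable setT
    (fun x => (mixture pi f x)%:E * log2 (mixture pi f x)%:E) ->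
  \int[@lebesgue R n]_x ((mixture pi f x)%:E * log2 (mixture pi f x)%:E) <=
  \sum_(c < K) (pi c)%:E * log2 (s c)%:E.
Proof.
move=> plogp_int.
have int_f c : (@lebesgue R n).-integrable setT (fun x => (f c x)%:E).
  have [_ _ fc1] := f_pdf c.
  apply/integrableP; split; first exact/measurable_EFinP.
  under eq_integral do rewrite gee0_abs ?lee_fin //.
  by rewrite fc1 ltry.
(* Integrability here is exactly the finiteness of [s c]. *)
have int_fp c : (@lebesgue R n).-integrable setT
    (fun x => (f c x * mixture pi f x)%:E).
  apply/integrableP; split => //.
  under eq_integral do rewrite gee0_abs //.
  by rewrite -sum_overlapE overlap_s ltry.
have int_bound c : (@lebesgue R n).-integrable setT (fun x =>
    (pi c * (ln (s c) - 1) / ln 2)%:E * (f c x)%:E +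
    (pi c / s c / ln 2)%:E * (f c x * mixture pi f x)%:E).
  by apply: integrableD => //; exact: integrableZl.
apply: (le_trans (le_integral _ plogp_int (integrable_sum _ _ _)
  (fun x _ => mixture_log2_le x))) => //.
rewrite integral_sum //; apply: lee_sum => c _.
rewrite integralD //; [|exact: integrableZl..].
rewrite !integralZl // -sum_overlapE overlap_s.
have [_ _ ->] := f_pdf c; rewrite log2_EFin // mule1 -!EFinM -EFinD lee_fin.
(* The second term integrates to [pi c / ln 2], which cancels the [- 1] in the first. *)
rewrite [leLHS](_ : _ = pi c * (ln (s c) / ln 2))%R //.
by field; rewrite !gt_eqF ?ln2_gt0.
Qed.

End finite_overlap.

(** In [\bar R] a single term [-oo] absorbs any [+oo] in a sum, so every term must first be shown to
    differ from [-oo]. *)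
Lemma entropy_lower_bound_Ny c :
  \sum_(d < K) (pi d)%:E * overlap f c d = +oo ->
  entropy_lower_bound pi f = -oo.
Proof.
move=> Scy; rewrite /entropy_lower_bound; set S := (X in - X).
suff -> : S = +oo by [].
apply/esum_eqyP => [i _|].
  have := sum_overlap_gt0 i; case: (\sum_(d < K) _) => [r r0| _ |//].
    by rewrite log2_EFin.
  by rewrite log2_pinfty gt0_muley // lte_fin.
exists c; split; rewrite ?mem_index_enum //.
by rewrite Scy log2_pinfty gt0_muley // lte_fin.
Qed.

End mixture.

Theorem lemma2 (R : realType) (n K : nat)
    (pi : 'I_K -> R) (f : 'I_K -> Rn R n -> R)
    (d : measure_display) (Omega : measurableType d)
    (P : probability Omega R) (X : {RV P >-> Rn R n}) :
  (1 <= n)%N -> (1 <= K)%N ->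
  (forall c : 'I_K, (0 < pi c)%R) ->
  (\sum_(c < K) pi c = 1)%R ->
  (forall c : 'I_K, is_pdf (f c)) ->
  has_density X (mixture pi f) ->
  finite_diff_entropy X ->
  entropy_lower_bound pi f <= diff_entropy X.
Proof.
move=> _ _ pi_gt0 _ f_pdf Xp Xfin.
have [[c Scy]|Sfin] := pselect
    (exists c, \sum_(d < K) (pi d)%:E * overlap f c d = +oo).
  by rewrite (entropy_lower_bound_Ny pi_gt0 f_pdf Scy) leNye.
(* Being positive and different from [+oo], each sum is real, so [fine] loses nothing and supplies
   [s]. *)
have overlap_s c : \sum_(d < K) (pi d)%:E * overlap f c d =
    (fine (\sum_(d < K) (pi d)%:E * overlap f c d))%:E.
  rewrite fineK // ge0_fin_numE ?ltW ?sum_overlap_gt0 // ltey.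
  by apply/eqP => Scy; apply: Sfin; exists c.
(* The entropy and its finiteness, defined through a Radon-Nikodym derivative, are carried over to
   the explicit mixture. *)
rewrite (diff_entropyE Xp) /entropy_lower_bound leeN2.
under [leRHS]eq_bigr do rewrite overlap_s.
by apply: integral_mixture_log2_le => //; exact/(finite_diff_entropyE Xp).
Qed.
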